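(* Let $I\subset\mathbb{R}$ be a closed interval and $f,g:I\to I$. Suppose $f$ is Lipschitz continuous, i.e. there is $M<\infty$ such that $|f(x)-f(y)|\le M|x-y|$ for all $x,y\in I$, and $g$ is contractive, i.e. there is $c<1$ such that $|g(x)-g(y)|\le c|x-y|$ for all $x,y\in I$. Suppose that $cM\ge 1$, and let $r$ be the smallest positive integer for which $c^rM\le 1$. If the probability $p\in[0,1]$ of choosing $f$ at each step satisfies $p<\frac{1}{1+r}$, then $\mu(f,g,p)=0$.
   Context: $I$ is a closed bounded interval of length $|I|>0$. For maps $f,g:I\to I$ and $p\in[0,1]$, consider the random dynamical system in which at each step, independently, $f$ is applied with probability $p$ and $g$ with probability $1-p$. Formally, $\Omega=\{f,g\}^{\infty}$ carries the product probability measure $P$ under which the coordinates $\omega_1,\omega_2,\ldots$ are independent with $P(\omega_i=f)=p$, $P(\omega_i=g)=1-p$ ($f$ and $g$ being treated as two distinct symbols). For $x\in I$ the trajectory is $x_0=x$, $x_n(\omega)=\omega_n\circ\omega_{n-1}\circ\cdots\circ\omega_1(x)$. For two starting points $x,y\in I$ the trajectories $x_n$ and $y_n$ are driven by the same $\omega$. Define, for $n\ge 1$ and $t\in\mathbb{R}$, $$F_{xy}^{(n)}(t)=\frac1n\sum_{i=0}^{n-1}P(|x_i-y_i|<t),\quad F_{xy}(t)=\liminf_{n\to\infty}F_{xy}^{(n)}(t),\quad F_{xy}^\star(t)=\limsup_{n\to\infty}F_{xy}^{(n)}(t),$$ and the measure of (distributional) chaos $$\mu(f,g,p)=\sup_{x,y\in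 I}\frac1{|I|}\int_0^{|I|}\bigl(F_{xy}^\star(t)-F_{xy}(t)\bigr)\,\mathrm{d}t .$$ *)

(* Defs.v *)
From HB Require Import structures.
From mathcomp Require Import all_boot all_order all_algebra finmap.
From mathcomp Require Import all_classical all_reals all_analysis.

Set Implicit Arguments.
Unset Strict Implicit.
Unset Printing Implicit Defensive.
Import Order.TTheory GRing.Theory Num.Theory.
Import numFieldNormedType.Exports.

Local Open Scope classical_set_scope.
Local Open Scope ring_scope.

(* The two symbols are coded by booleans: [true] stands for f, [false] for g,
   so that they stay distinct even when the two maps coincide. *)
Definition cylinders : set (set (nat -> bool)) :=
  [set C | exists (n : nat) (B : set bool), C = [set w | B (w n)]].

(* {f, g}^oo with its product sigma-algebra; the paper's omega_(n+1) is
   [w n]. *)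
Definition symbol_seq := g_sigma_algebraType cylinders.

Definition coord (n : nat) (w : symbol_seq) : bool := w n.

Definition mutually_independent d (T : measurableType d) (R : realType)
    (P : probability T R) d' (U : measurableType d') (X : nat -> T -> U) :=
  forall (J : {fset nat}) (A : nat -> set U),
    (forall i, measurable (A i)) ->
    P (\bigcap_(i in [set` J]) (X i @^-1` A i)) =
    (\prod_(i <- J) P (X i @^-1` A i))%E.

(* On the sigma-algebra of [symbol_seq] these conditions determine P
   uniquely. *)
Definition is_bernoulli_product (R : realType) (p : R)
    (P : probability symbol_seq R) :=
  mutually_independent P coord /\
  forall n, P [set w | coord n w = true] = p%:E /\
            P [set w | coord n w = false] = (1 - p)%:E.

Section chaos.
Context (R : realType) (f g : R -> R).

Fixpoint traj (w : symbol_seq) (x : R) (n : nat) : R :=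
  if n is m.+1 then (if coord m w then f else g) (traj w x m) else x.

Context (P : probability symbol_seq R).

(* At n = 0 this is 0, which is irrelevant for the limits below. *)
Definition distribution_avg (x y : R) (n : nat) (t : R) : \bar R :=
  (((n%:R)^-1)%:E *
   \sum_(0 <= i < n) P [set w | (`|traj w x i - traj w y i| < t)%R])%E.

Definition lower_distribution (x y t : R) : \bar R :=
  limn_einf (fun n => distribution_avg x y n t).

Definition upper_distribution (x y t : R) : \bar R :=
  limn_esup (fun n => distribution_avg x y n t).

Definition chaos_measure (a b : R) : \bar R :=
  ereal_sup [set z | exists x y : R, [/\ x \in `[a, b], y \in `[a, b] &
    z = (((b - a)^-1)%:E *
      \int[lebesgue_measure]_(t in `[0%R, (b - a)%R])
        (upper_distribution x y t - lower_distribution x y t))%E]].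

End chaos.

(* Main.v *)
(** The distance between the two trajectories is multiplied by at most M at
    each f-step and by at most c at each g-step.  The hypothesis on p says that
    the mean logarithmic rate p ln M + (1 - p) ln c is negative, so some moment
    s > 0 satisfies rho := p M^s + (1 - p) c^s < 1.  By independence the s-th
    moment of the distance after n steps is at most |x - y|^s rho^n, so by
    Markov's inequality P(|x_n - y_n| < t) tends to 1 for every t > 0.  The
    Cesaro means then have limit 1, and the upper and lower distribution
    functions coincide on the whole of [0, |I|]. *)

Require Import Defs.
From HB Require Import structures.
From mathcomp Require Import all_boot all_order all_algebra finmap.
From mathcomp Require Import all_classical all_reals all_analysis.
From mathcomp Require Import ring lra.

Set Implicit Arguments.
Unset Strict Implicit.
Unset Printing Implicit Defensive.
Import Order.TTheory GRing.Theory Num.Theory.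
Import numFieldNormedType.Exports.

Local Open Scope classical_set_scope.
Local Open Scope ring_scope.

(** * Events determined by finitely many symbols *)

Definition prefix_seq n (v : {ffun 'I_n -> bool}) : symbol_seq :=
  fun i => oapp v false (insub i).

Lemma prefix_seqE n (v : {ffun 'I_n -> bool}) (i : 'I_n) : prefix_seq v i = v i.
Proof. by rewrite /prefix_seq valK. Qed.

Lemma measurable_coord (n : nat) (B : set bool) :
  measurable (Defs.coord n @^-1` B).
Proof. by apply: sub_sigma_algebra; exists n, B. Qed.

Definition cylinder n (v : {ffun 'I_n -> bool}) : set symbol_seq :=
  [set w | forall i : 'I_n, Defs.coord i w = v i].

(** This is the shape that [mutually_independent] asks for. Its sets are indexed by all naturals,
    hence the padded word [prefix_seq v] in place of [v]. *)
Lemma cylinderE n (v : {ffun 'I_n -> bool}) :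
  cylinder v = \bigcap_(i in [set` [fset i in iota 0 n]%fset])
                 Defs.coord i @^-1` [set prefix_seq v i].
Proof.
apply/seteqP; split => [w vw i /=|w vw i].
  rewrite !inE mem_iota => /= i_lt_n.
  by have := vw (Ordinal i_lt_n); rewrite -prefix_seqE.
by rewrite -prefix_seqE; apply: vw; rewrite /= !inE mem_iota /=.
Qed.

Lemma measurable_cylinder n (v : {ffun 'I_n -> bool}) : measurable (cylinder v).
Proof.
rewrite cylinderE; apply: fin_bigcap_measurable => // i _.
exact: measurable_coord.
Qed.

Lemma prefix_eventE n (Q : pred {ffun 'I_n -> bool}) :
  [set w : symbol_seq | Q [ffun i : 'I_n => Defs.coord i w]] =
  \bigcup_(v in [set` enum Q]) cylinder v.
Proof.
apply/seteqP; split => [w Qw|w [v /= vQ vw]].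
  by exists [ffun i : 'I_n => Defs.coord i w] => [/=|i];
    rewrite ?mem_enum ?ffunE.
rewrite mem_enum in vQ.
by rewrite /= (_ : [ffun i => _] = v)//; apply/ffunP => i; rewrite ffunE.
Qed.

Lemma measurable_prefix n (Q : pred {ffun 'I_n -> bool}) :
  measurable [set w : symbol_seq | Q [ffun i : 'I_n => Defs.coord i w]].
Proof.
rewrite prefix_eventE; apply: fin_bigcup_measurable => // v _.
exact: measurable_cylinder.
Qed.

(** * Probabilities of prefix events *)

Section bernoulli.
Context (R : realType) (p : R) (P : probability symbol_seq R).
Hypothesis hP : is_bernoulli_product p P.

Definition symbol_weight (b : bool) : R := if b then p else 1 - p.

Lemma probability_coord n b :
  P (Defs.coord n @^-1` [set b]) = (symbol_weight b)%:E.
Proof. by have [] := hP.2 n; case: b. Qed.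

Lemma probability_cylinder n (v : {ffun 'I_n -> bool}) :
  P (cylinder v) = (\prod_(i < n) symbol_weight (v i))%:E.
Proof.
rewrite cylinderE (hP.1 _ (fun i => [set prefix_seq v i])) => [|//].
rewrite (perm_big (iota 0 n)); last first.
  by apply: uniq_perm; rewrite ?fset_uniq ?iota_uniq// => i; rewrite !inE.
under eq_bigr do rewrite probability_coord.
have -> : iota 0 n = index_iota 0 n by rewrite /index_iota subn0.
rewrite prodEFin big_mkord.
by under eq_bigr do rewrite prefix_seqE.
Qed.

Lemma probability_prefix n (Q : pred {ffun 'I_n -> bool}) :
  P [set w | Q [ffun i : 'I_n => Defs.coord i w]] =
  (\sum_(v | Q v) \prod_(i < n) symbol_weight (v i))%:E.
Proof.
rewrite prefix_eventE measure_fin_bigcup //; last 2 first.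
- move=> v v' _ _ [w [vw v'w]]; apply/ffunP => i.
  by rewrite -vw -v'w.
- by move=> v _; exact: measurable_cylinder.
rewrite -fsbig_seq ?enum_uniq// big_enum /=.
by under eq_bigr do rewrite probability_cylinder; rewrite sumEFin.
Qed.

(* Markov's inequality: by independence the expectation of
   [\prod_(i < n) phi (w i)] is [(p * phi true + (1 - p) * phi false) ^+ n]. *)
Lemma probability_prefix_markov n (Q : pred {ffun 'I_n -> bool})
    (phi : bool -> R) (C : R) :
  0 <= p <= 1 -> (forall b, 0 <= phi b) -> 0 <= C ->
  (forall v, Q v -> 1 <= C * \prod_(i < n) phi (v i)) ->
  (P [set w | Q [ffun i : 'I_n => Defs.coord i w]] <=
   (C * (p * phi true + (1 - p) * phi false) ^+ n)%:E)%E.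
Proof.
move=> /andP[p0 p1] phi0 C0 Qphi; rewrite probability_prefix lee_fin.
have weight0 b : 0 <= symbol_weight b by case: b; rewrite /= ?subr_ge0.
pose h b := symbol_weight b * phi b.
have -> : p * phi true + (1 - p) * phi false = \sum_b h b.
  by rewrite big_bool.
(* The power expands into a sum over all words of length n; the words outside [Q] contribute
   nonnegative terms and are dropped. *)
rewrite -[n in X in _ <= X]card_ord -prodr_const.
rewrite (bigA_distr_bigA (fun _ => h)) mulr_sumr.
rewrite [leRHS](bigID Q) /= -[leLHS]addr0 lerD//; last first.
  apply: sumr_ge0 => v _; apply: mulr_ge0 => //.
  by apply: prodr_ge0 => i _; exact: mulr_ge0.
apply: ler_sum => v Qv; rewrite big_split /= mulrCA.
by rewrite ler_peMr ?Qphi// prodr_ge0.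
Qed.

End bernoulli.

(** * Trajectories as functions of finite words *)

Section trajectories.
Context (R : realType) (f g : R -> R).

Lemma eq_traj (w w' : symbol_seq) x n :
  (forall i, (i < n)%N -> Defs.coord i w = Defs.coord i w') ->
  traj f g w x n = traj f g w' x n.
Proof.
by elim: n => //= n IH eqw; rewrite eqw// IH// => i /ltnW; exact: eqw.
Qed.

(** The first n steps never read a symbol beyond the prefix, so the padding is harmless and the
    event reduces to a condition on words. *)
Lemma traj_eventE (Q : rel R) x y n :
  [set w | Q (traj f g w x n) (traj f g w y n)] =
  [set w | [pred v | Q (traj f g (prefix_seq v) x n)
                       (traj f g (prefix_seq v) y n)]
           [ffun i : 'I_n => Defs.coord i w]].
Proof.
apply/eq_set => w /=; rewrite -!(@eq_traj w) // => i i_lt_n;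
  by rewrite /Defs.coord (prefix_seqE _ (Ordinal i_lt_n)) ffunE.
Qed.

Lemma measurable_traj_event (Q : rel R) x y n :
  measurable [set w : symbol_seq | Q (traj f g w x n) (traj f g w y n)].
Proof. by rewrite traj_eventE; exact: measurable_prefix. Qed.

End trajectories.

(** * Growth of the distance and choice of the moment s *)

Section contraction.
Context (R : realType) (a b : R) (f g : R -> R) (M c : R).
Hypothesis hfI : forall x : R, x \in `[a, b] -> f x \in `[a, b].
Hypothesis hgI : forall x : R, x \in `[a, b] -> g x \in `[a, b].
Hypothesis hf : forall x y : R, x \in `[a, b] -> y \in `[a, b] ->
  `|f x - f y| <= M * `|x - y|.
Hypothesis hg : forall x y : R, x \in `[a, b] -> y \in `[a, b] ->
  `|g x - g y| <= c * `|x - y|.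

Lemma traj_in w x n : x \in `[a, b] -> traj f g w x n \in `[a, b].
Proof.
by move=> xI; elim: n => //= n IH; case: (Defs.coord n w); [exact: hfI|exact: hgI].
Qed.

(** One factor per symbol is the form needed for [phi] in [probability_prefix_markov]. *)
Lemma traj_dist_powR w x y n s : 0 <= M -> 0 <= c -> 0 <= s ->
  x \in `[a, b] -> y \in `[a, b] ->
  `|traj f g w x n - traj f g w y n| `^ s <=
  `|x - y| `^ s * \prod_(i < n) (if Defs.coord i w then M `^ s else c `^ s).
Proof.
move=> M0 c0 s0 xI yI; elim: n => [|n IH]; first by rewrite big_ord0 mulr1.
rewrite big_ord_recr /= mulrA.
apply: le_trans (ler_wpM2r _ IH); last by case: ifP; rewrite powR_ge0.
have [xn yn] := (traj_in w n xI, traj_in w n yI).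
by case: (Defs.coord n w); rewrite mulrC -powRM// ge0_ler_powR ?nnegrE ?mulr_ge0//;
  [exact: hf|exact: hg].
Qed.

End contraction.

(* For [M > 0] the left-hand side, as a function of [s], equals [1] at [s = 0]
   with slope [p * ln M + (1 - p) * ln c <= (p * (1 + r) - 1) * - ln c < 0].
   The proof replaces this by an explicit [s], chosen so that
   [c `^ s = 1 - e], and Bernoulli's bound [1 - r * e <= (1 - e) ^+ r]. *)
Lemma exists_contracting_moment (R : realType) (M c p : R) (r : nat) :
  0 < c < 1 -> 0 <= M -> (0 < r)%N -> c ^+ r * M <= 1 ->
  0 <= p <= 1 -> p < 1 / (1 + r%:R) ->
  exists2 s : R, 0 < s & p * M `^ s + (1 - p) * c `^ s < 1.
Proof.
move=> /andP[c0 c1] M0 r0 cM /andP[p0 p1].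
have r1 : 1 <= r%:R :> R by rewrite ler1n.
rewrite ltr_pdivlMr ?ltr_wpDr// => pr.
(* Chosen so that [r%:R * e] is half of the positive gap [1 - p * (1 + r%:R)]. *)
pose e : R := (1 - p * (1 + r%:R)) / (2 * r%:R).
have re : r%:R * e = (1 - p * (1 + r%:R)) / 2 by rewrite /e; field; lra.
have e0 : 0 < e by rewrite divr_gt0//; lra.
have pr0 : 0 <= p * (1 + r%:R) by rewrite mulr_ge0//; lra.
have e1 : e < 1 by nra.
pose q := 1 - e.
have q0 : 0 < q by rewrite /q; lra.
have lnc0 : ln c < 0 by rewrite ln_lt0// c0.
have lnq0 : ln q < 0 by rewrite ln_lt0// q0/= /q; lra.
pose s := ln q / ln c.
have s0 : 0 < s by rewrite /s -mulrNN -invrN divr_gt0 ?oppr_gt0.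
have csE : c `^ s = q.
  by rewrite /powR gt_eqF// /s divfK ?lt_eqF// lnK ?posrE.
have qM : q ^+ r * M `^ s <= 1.
  rewrite -csE -powR_mulrn ?powR_ge0// powRAC powR_mulrn ?(ltW c0)//.
  rewrite -powRM ?exprn_ge0 ?(ltW c0)//.
  rewrite -[leRHS](_ : 1 `^ s = 1); last by rewrite powR1.
  apply: (ge0_ler_powR (ltW s0)) => //; rewrite nnegrE// mulr_ge0//.
  by rewrite exprn_ge0// ltW.
have bern : 1 - r%:R * e <= q ^+ r.
  rewrite /q; elim: (r) => [|k IH]; first by rewrite mul0r subr0.
  rewrite exprS -natr1.
  have k0 : 0 <= k%:R * e by rewrite mulr_ge0// ltW.
  apply: le_trans (ler_wpM2l (ltW q0) IH); rewrite /q.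
  nra.
exists s => //; rewrite csE.
have Ms0 := powR_ge0 M s.
set m := M `^ s in qM Ms0 *.
have m1 : (1 - r%:R * e) * m <= 1 by apply: le_trans qM; rewrite ler_wpM2r.
set d := r%:R * e in re m1 *.
have d12 : 0 < d <= 1 / 2 by rewrite re; apply/andP; split; lra.
(* This is the goal multiplied by [1 - d], with [(1 - d) * m] bounded by 1. As [1 - p * (1 + r%:R)]
   equals [2 * d], the factor of [e] below is [d * (1 + p)], which is positive. *)
have key : p < (1 - d) * (1 - (1 - p) * q).
  have -> : (1 - d) * (1 - (1 - p) * q) =
      p + e * ((1 - p) - r%:R * p - d * (1 - p)).
    by rewrite /d /q; ring.
  rewrite ltrDl mulr_gt0// re; nra.
have d0 : 0 < 1 - d by lra.
rewrite -ltrBrDr -(ltr_pM2l d0); apply: le_lt_trans key.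
by rewrite mulrCA -{2}[p]mulr1 ler_wpM2l.
Qed.

(** * From convergence in probability to zero chaos *)

Section distributions.
Context (R : realType) (f g : R -> R) (P : probability symbol_seq R).

Lemma distribution_eq1 x y t :
  P [set w | `|traj f g w x n - traj f g w y n| < t] @[n --> \oo] --> 1%E ->
  upper_distribution f g P x y t = 1%E /\
  lower_distribution f g P x y t = 1%E.
Proof.
set E := fun n => [set w | `|traj f g w x n - traj f g w y n| < t].
have finE n : P (E n) \is a fin_num.
  apply: fin_num_measure.
  exact: (measurable_traj_event _ _ (fun u v => `|u - v| < t)).
move=> /fine_cvgP[_ /cesaro avg1].
suff avg_cvg : distribution_avg f g P x y n t @[n --> \oo] --> 1%E.
  by split; apply cvg_limn_einf_sup.
(* [arithmetic_mean] at n averages n + 1 terms, hence the shift. *)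
rewrite -cvg_shiftS /=.
have -> : (fun n => distribution_avg f g P x y n.+1 t) =
    (fun n => (arithmetic_mean (fun n => fine (P (E n))) n)%:E).
  apply/funext => n.
  rewrite /distribution_avg /arithmetic_mean /= /series /= EFinM -sumEFin.
  by congr (_ * _)%E; apply: eq_bigr => i _; rewrite fineK.
exact: cvg_EFin (nearW _ _) avg1.
Qed.

(** Covers the endpoint t = 0 of the integration range, where the strict inequality makes every
    event empty. *)
Lemma distribution_nonpos x y t : t <= 0 ->
  upper_distribution f g P x y t = 0%E /\
  lower_distribution f g P x y t = 0%E.
Proof.
move=> t0.
have avg0 : (fun n => distribution_avg f g P x y n t) = cst 0%E.
  apply/funext => n; rewrite /distribution_avg big1 ?mule0// => i _.
  rewrite [X in P X](_ : _ = set0) ?measure0//.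
  apply/seteqP; split => // w /=.
  by move=> /lt_le_trans /(_ t0); rewrite normr_lt0.
rewrite /upper_distribution /lower_distribution avg0.
by split; apply cvg_limn_einf_sup; exact: cvg_cst.
Qed.

Lemma chaos_measure_eq0 a b : a <= b ->
  (forall x y t : R, x \in `[a, b] -> y \in `[a, b] -> 0 < t ->
   P [set w | `|traj f g w x n - traj f g w y n| < t] @[n --> \oo] --> 1%E) ->
  chaos_measure f g P a b = 0%E.
Proof.
move=> ab sync; rewrite /chaos_measure.
have int0 x y : x \in `[a, b] -> y \in `[a, b] ->
    (\int[lebesgue_measure]_(t in `[0%R, (b - a)%R])
      (upper_distribution f g P x y t - lower_distribution f g P x y t) = 0)%E.
  move=> xI yI; apply: integral0_eq => t _.
  have [t0|t0] := lerP t 0.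
    by have [-> ->] := distribution_nonpos x y t0; rewrite sube0.
  have [-> ->] := distribution_eq1 (sync x y t xI yI t0).
  by rewrite subee.
rewrite [X in ereal_sup X](_ : _ = [set 0%E]) ?ereal_sup1//.
apply/seteqP; split => [_ [x [y [xI yI ->]]]|_ ->] /=.
  by rewrite int0// mule0.
(* A witness is required: the supremum of the empty set would be -oo. *)
have aI : a \in `[a, b] by rewrite in_itv/= lexx ab.
by exists a, a; split => //; rewrite int0// mule0.
Qed.

End distributions.

Theorem theorem4p4 (R : realType) (a b : R) (f g : R -> R) (M c p : R)
  (r : nat) (P : probability symbol_seq R)
  (hab : a < b)
  (hfI : forall x : R, x \in `[a, b] -> f x \in `[a, b])
  (hgI : forall x : R, x \in `[a, b] -> g x \in `[a, b])
  (hf : forall x y : R, x \in `[a, b] -> y \in `[a, b] ->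
        `|f x - f y| <= M * `|x - y|)
  (hc : c < 1)
  (hg : forall x y : R, x \in `[a, b] -> y \in `[a, b] ->
        `|g x - g y| <= c * `|x - y|)
  (hcM : 1 <= c * M)
  (hr0 : (0 < r)%N)
  (hr : c ^+ r * M <= 1)
  (hrmin : forall k : nat, (0 < k)%N -> c ^+ k * M <= 1 -> (r <= k)%N)
  (hp01 : 0 <= p <= 1)
  (hp : p < 1 / (1 + r%:R))
  (hP : is_bernoulli_product p P) :
  chaos_measure f g P a b = 0%E.
Proof.
have aI : a \in `[a, b] by rewrite in_itv/= lexx ltW.
have bI : b \in `[a, b] by rewrite in_itv/= lexx ltW.
have ab0 : 0 < `|b - a| by rewrite normr_gt0 subr_eq0 gt_eqF.
(* The Lipschitz bounds at the distinct endpoints force c and M to be nonnegative; [hcM] then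
   excludes c = 0. *)
have c_ge0 : 0 <= c.
  by rewrite -(pmulr_lge0 _ ab0); exact: le_trans (normr_ge0 _) (hg _ _ bI aI).
have M0 : 0 <= M.
  by rewrite -(pmulr_lge0 _ ab0); exact: le_trans (normr_ge0 _) (hf _ _ bI aI).
have c0 : 0 < c.
  rewrite lt_neqAle c_ge0 andbT; apply: contraTneq hcM => <-.
  by rewrite mul0r -ltNge.
have [|s s0 rho1] := exists_contracting_moment _ M0 hr0 hr hp01 hp.
  by rewrite c0.
set rho := _ + _ in rho1.
have rho0 : 0 <= rho.
  by case/andP: hp01 => ? ?; rewrite addr_ge0// mulr_ge0 ?powR_ge0 ?subr_ge0.
apply: chaos_measure_eq0; first exact: ltW.
move=> x y t xI yI t0.
pose C := `|x - y| `^ s / t `^ s.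
have C0 : 0 <= C by rewrite divr_ge0 ?powR_ge0.
have far n : (P [set w | (t <= `|traj f g w x n - traj f g w y n|)%R] <=
    (C * rho ^+ n)%:E)%E.
  rewrite (traj_eventE _ _ (fun u v => t <= `|u - v|)).
  apply: (probability_prefix_markov hP
    (phi := fun b => if b then M `^ s else c `^ s)) => //.
    by case; rewrite powR_ge0.
  move=> v /= tD; rewrite /C mulrAC ler_pdivlMr ?powR_gt0// mul1r.
  have -> : \prod_(i < n) (if v i then M `^ s else c `^ s) =
      \prod_(i < n) (if Defs.coord i (prefix_seq v) then M `^ s else c `^ s).
    by apply: eq_bigr => i _; rewrite /Defs.coord prefix_seqE.
  apply: le_trans (traj_dist_powR hfI hgI hf hg _ n _ _ _ xI yI) => //;
    last exact: ltW.
  by rewrite ge0_ler_powR ?nnegrE// ltW.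
apply: (@squeeze_cvge _ _ _ _ (fun n => (1 - C * rho ^+ n)%:E) _ (cst 1%E)).
- apply: nearW => n; apply/andP; split; last first.
    apply: probability_le1.
    exact: (measurable_traj_event _ _ (fun u v => `|u - v| < t)).
  rewrite [X in P X](_ : _ =
    ~` [set w | t <= `|traj f g w x n - traj f g w y n|]).
    rewrite probability_setC ?EFinB ?leeB//.
    exact: (measurable_traj_event _ _ (fun u v => t <= `|u - v|)).
  by apply/seteqP; split => w /=; [rewrite ltNge => /negP|rewrite ltNge => /negP].
- apply: cvg_EFin; first by apply: nearW.
  rewrite -[X in _ --> X]subr0; apply: cvgB; first exact: cvg_cst.
  by apply: cvg_geometric; rewrite ger0_norm.
- exact: cvg_cst.
Qed.
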